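(* Let $0\le\alpha<1$ and $\theta>-\alpha$, and let $X_1,X_2,\dots$ have the $\mathsf{GEM}(\alpha,\theta)$ exchangeable distribution. Let $M_n=\max\{X_1,\dots,X_n\}$ and let $$L_n=\sum_{j=1}^n\mathbf{1}_{\{X_j=M_n\}}$$ be the number of values in the sample of size $n$ equal to the maximum. Then $$\mathbb{P}\bigl[\limsup_{n\to\infty}L_n=1\bigr]=1\quad\text{if }\alpha>0,\qquad \mathbb{P}\bigl[\limsup_{n\to\infty}L_n=\infty\bigr]=1\quad\text{if }\alpha=0.$$
   Context: $\mathbb{N}=\{1,2,\dots\}$. The $\mathsf{GEM}(\alpha,\theta)$ exchangeable distribution ($0\le\alpha<1$, $\theta>-\alpha$): let $H_1,H_2,\dots$ be independent random variables, $H_i$ having the beta$(1-\alpha,\theta+i\alpha)$ distribution, i.e. density $\frac{1}{B(1-\alpha,\theta+i\alpha)}x^{-\alpha}(1-x)^{\theta+i\alpha-1}$ on $[0,1]$, where $B$ is Euler's beta function. Put $Y_k=1-\prod_{i=1}^k(1-H_i)$ for $k\in\mathbb{N}$; then $Y_k\uparrow1$ a.s. Given $\mathbf{Y}=(Y_k)_{k\ge1}$, let $X_1,X_2,\dots$ be i.i.d. with values in $\mathbb{N}$ and $\mathbb{P}[X_1\le k\mid\mathbf{Y}]=Y_k$ for all $k\in\mathbb{N}$. The unconditional law of $(X_1,X_2,\dots)$ is the $\mathsf{GEM}(\alpha,\theta)$ exchangeable distribution. *)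

(* Defs.v *)
From HB Require Import structures.
From mathcomp Require Import all_boot all_order all_algebra.
From mathcomp Require Import all_classical all_reals all_analysis.

Set Implicit Arguments.
Unset Strict Implicit.
Unset Printing Implicit Defensive.

Import Order.TTheory GRing.Theory Num.Theory.
Import numFieldNormedType.Exports.

Local Open Scope classical_set_scope.
Local Open Scope ring_scope.

(* [beta_fun] and [beta_pdf] of MathComp-Analysis take natural-number
   parameters only; these are the versions with real parameters. *)
Definition euler_beta (R : realType) (a b : R) : R :=
  \int[lebesgue_measure]_(x in `[0, 1]) (x `^ (a - 1) * (1 - x) `^ (b - 1)).

Definition beta_density (R : realType) (a b : R) : R -> R :=
  (fun x => (euler_beta a b)^-1 * x `^ (a - 1) * (1 - x) `^ (b - 1)) \_ `[0, 1].

Section probability_notions.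
Context {R : realType} {d : measure_display} {T : measurableType d}.
Variable P : probability T R.

Definition has_beta_law (a b : R) (H : T -> R) : Prop :=
  forall A : set R, measurable A ->
    P (H @^-1` A) = (\int[lebesgue_measure]_(x in A) (beta_density a b x)%:E)%E.

Definition independent_seq {d'} {T' : measurableType d'} (H : nat -> T -> T')
    : Prop :=
  forall (J : seq nat) (A : nat -> set T'), uniq J ->
    (forall i, measurable (A i)) ->
    P (\bigcap_(i in [set` J]) H i @^-1` A i) =
      (\prod_(i <- J) P (H i @^-1` A i))%E.

(* [f] is a version of the conditional probability P[A | G]. *)
Definition is_cond_prob (G : set (set T)) (A : set T) (f : T -> R) : Prop :=
  [/\ forall B : set R, measurable B -> G (f @^-1` B),
      P.-integrable setT (EFin \o f) &
      forall B, G B -> (\int[P]_(w in B) (f w)%:E)%E = P (A `&` B)].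

Definition cond_independent_seq {d'} {T' : measurableType d'}
    (G : set (set T)) (X : nat -> T -> T') : Prop :=
  forall (n : nat) (A : nat -> set T') (f : nat -> T -> R),
    (forall j, (j < n)%N -> measurable (A j)) ->
    (forall j, (j < n)%N -> is_cond_prob G (X j @^-1` A j) (f j)) ->
    is_cond_prob G (\bigcap_(j in `I_n) X j @^-1` A j)
      (fun w => \prod_(j < n) f j w).

End probability_notions.

(* The sigma-algebra on [T] generated by the maps [Y 0], [Y 1], ... With
   [T := nat -> T'] and [Y] the coordinate maps it is the product
   sigma-algebra on sequences. *)
Definition sigma_seq {T : Type} {d'} {T' : measurableType d'}
    (Y : nat -> T -> T') : set (set T) :=
  <<s \bigcup_k preimage_set_system setT (Y k) measurable >>.

(* Sequences start at index 0: [H i] is H_(i+1), whereas [stick_breaking H k]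
   is Y_k, with Y_0 = 0. *)
Definition stick_breaking {R : realType} {T : Type} (H : nat -> T -> R)
    (k : nat) (w : T) : R :=
  1 - \prod_(i < k) (1 - H i w).

(* The two-stage construction on one probability space. The values of [X j],
   i.e. X_(j+1), are in {1, 2, ...}. *)
Definition gem_construction {R : realType} {d} {T : measurableType d}
    (P : probability T R) (alpha theta : R)
    (H : nat -> {RV P >-> R}) (X : nat -> {RV P >-> nat}) : Prop :=
  let Y := stick_breaking (fun i w => H i w) in
  [/\ independent_seq P (fun i w => H i w),
      forall i, has_beta_law P (1 - alpha) (theta + i.+1%:R * alpha) (H i),
      forall j w, (0 < X j w)%N,
      cond_independent_seq P (sigma_seq Y) (fun j w => X j w) &
      forall j k, is_cond_prob P (sigma_seq Y) [set w | (X j w <= k)%N] (Y k)].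

(* Only the law of [X] on the sequence space is prescribed: the variables H_i
   need not be defined on the space carrying [X]. *)
Definition gem_exchangeable {R : realType} {d} {T : measurableType d}
    (P : probability T R) (alpha theta : R) (X : nat -> {RV P >-> nat}) : Prop :=
  (forall j w, (0 < X j w)%N) /\
  exists (d' : measure_display) (T' : measurableType d')
    (P' : probability T' R) (H : nat -> {RV P' >-> R})
    (X' : nat -> {RV P' >-> nat}),
    gem_construction alpha theta H X' /\
    forall A : set (nat -> nat), sigma_seq (fun j (x : nat -> nat) => x j) A ->
      P [set w | A (fun j => X j w)] = P' [set w | A (fun j => X' j w)].

Definition sample_max {T : Type} (X : nat -> T -> nat) (n : nat) (w : T) : nat :=
  (\max_(j < n) X j w)%N.

Definition max_multiplicity {T : Type} (X : nat -> T -> nat) (n : nat) (w : T)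
    : nat :=
  (\sum_(j < n) (X j w == sample_max X n w))%N.

(* Main.v *)
Require Import Defs.
From HB Require Import structures.
From mathcomp Require Import all_boot all_order all_algebra.
From mathcomp Require Import all_classical all_reals all_analysis.
From mathcomp Require Import measurable_realfun.
From mathcomp Require Import ring lra zify.

Set Implicit Arguments.
Unset Strict Implicit.
Unset Printing Implicit Defensive.

Import Order.TTheory GRing.Theory Num.Theory.
Import numFieldNormedType.Exports.

Local Open Scope classical_set_scope.
Local Open Scope ring_scope.

(** Fix the stick lengths h_0, h_1, ... and put S_k = (1 - h_0) ... (1 - h_{k-1}).
    A sample entry exceeds k with probability S_k and equals k+1 with
    probability S_k h_k, so the first entry exceeding k equals k+1 with
    probability h_k, whatever happened before.  Hence the first m entries
    exceeding k are all equal to k+1 with probability h_k ^ m.  On the other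
    hand this event says exactly that, at some time n, the maximum of the first
    n entries is k+1 and is attained at least m times.  Averaging over the
    sticks, the behaviour of limsup L_n is a Borel-Cantelli question about
    events A_k of probability E[h_k ^ m].

    If alpha > 0, take m = 2.  The moments of the beta law give
      E[h_k ^ 2] <= 2 / ((s + k alpha) (s + (k+1) alpha)),  s = 1 + theta,
    which telescopes to a finite sum.  Almost surely only finitely many values
    are ever attained twice while being the maximum; as the maximum tends to
    infinity, L_n = 1 for all large n.

    If alpha = 0, the sticks are i.i.d., so P(A_k) = c > 0 does not depend on k,
    and P(A_k and A_l) <= E[h_k ^ m h_l ^ m] = c ^ 2 for k <> l.  A second moment
    argument then shows that almost surely infinitely many A_k occur, for every
    m, so limsup L_n is infinite.

    The events are written with [unit_exceedances]; the combinatorial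
    dictionary is [unit_exceedances_nseqP] and [unit_exceedances_cat], their law
    is [unit_exceedances_law], the moment bound is [beta_law_second_moment] and
    the second moment argument is [pairwise_Borel_Cantelli]. *)

(** * Runs of equal values that exceed a level for the first time *)

Lemma sum_nat_shift (F : nat -> nat) (g n : nat) :
  (\sum_(g <= j < n) F j = \sum_(0 <= j < n - g) F (g + j))%N.
Proof. by rewrite -{1}[g]add0n big_addn; under eq_bigr do rewrite addnC. Qed.

(** The first entry of [x] above the first level overshoots it by exactly 1,
    and the part of [x] after that entry behaves likewise for the remaining
    levels.  Levels are consumed together with the entries, which makes the
    probability of the event a product over the levels. *)
Fixpoint unit_exceedances (ks : seq nat) (x : nat -> nat) : Prop :=
  if ks is k :: ks' then
    exists g, [/\ forall i, (i < g)%N -> (x i <= k)%N, x g = k.+1 &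
      unit_exceedances ks' (fun i => x (g.+1 + i)%N)]
  else True.

(** Entries that are at most [k] do not count towards the level [k], so the
    first [m] entries above [k] are all [k.+1] as soon as some prefix bounded by
    [k.+1] contains [m] copies of [k.+1]. *)
Lemma unit_exceedances_nseqP (m k : nat) (x : nat -> nat) :
  unit_exceedances (nseq m k) x <->
  exists2 n, (forall j, (j < n)%N -> (x j <= k.+1)%N) &
             (m <= \sum_(0 <= j < n) (x j == k.+1))%N.
Proof.
elim: m x => [|m IHm] x /=; first by split=> // _; exists 0%N.
split=> [[g [xlt xg /IHm[n xle Hn]]]|[n xle Hn]].
  exists (g.+1 + n)%N.
    move=> j jn; have [jg|jg] := ltnP j g; first exact: leqW (xlt _ jg).
    move: jg; rewrite leq_eqVlt => /predU1P[<-|gj]; first by rewrite xg.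
    by have := xle (j - g.+1)%N; rewrite subnKC//; apply; lia.
  rewrite (@big_cat_nat _ _ _ g.+1)//= ?leq_addr// big_nat_recr//= xg eqxx.
  rewrite (sum_nat_shift _ g.+1) addKn.
  by rewrite addn1 addSn ltnS (leq_trans Hn)// leq_addl.
have [j jn xj] : exists2 j, (j < n)%N & x j = k.+1.
  apply: contrapT => H; move: Hn; rewrite big_nat big1 // => j /= jn.
  by apply/eqP; rewrite eqb0; apply/eqP => xj; apply: H; exists j.
have exg : exists j, (k < x j)%N by exists j; rewrite xj.
case: (ex_minnP exg) => g kg gmin.
have gj : (g <= j)%N by apply: gmin; rewrite xj.
have gn : (g < n)%N by exact: leq_ltn_trans gj jn.
have xlt i : (i < g)%N -> (x i <= k)%N.
  by move=> ig; rewrite leqNgt; apply: contraL ig => /gmin; rewrite -leqNgt.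
have xg : x g = k.+1 by apply/eqP; rewrite eqn_leq kg andbT xle.
exists g; split=> //; apply/IHm; exists (n - g.+1)%N.
  by move=> i ing; apply: xle; lia.
move: Hn; rewrite (@big_cat_nat _ _ _ g.+1)//= big_nat_recr//= xg eqxx.
rewrite big_nat big1 => [|i /= /xlt xik]; last first.
  by apply/eqP; rewrite eqb0 ltn_eqF.
by rewrite (sum_nat_shift _ g.+1).
Qed.

(** A run at level [k] ends before anything above [l] has appeared, because all
    entries up to its end are at most [k.+1 <= l]; dropping them does not affect
    the run at level [l].  This turns the intersection of two such events into a
    single one. *)
Lemma unit_exceedances_cat (m k l : nat) (ks : seq nat) (x : nat -> nat) :
  (k < l)%N -> unit_exceedances (nseq m k) x -> unit_exceedances (l :: ks) x ->
  unit_exceedances (nseq m k ++ l :: ks) x.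
Proof.
move=> kl; elim: m x => [//|m IHm] x /= [g [xlt xg Hm]] [h [xle xh Hks]].
have gh : (g < h)%N.
  rewrite ltnNge leq_eqVlt; apply/negP => /predU1P[hg|/xlt].
    by move: xh; rewrite hg xg => -[kl']; rewrite kl' ltnn in kl.
  by rewrite xh => lk; have := leq_trans (ltnW kl) (ltnW lk); lia.
exists g; split=> //; apply: IHm Hm _; exists (h - g.+1)%N; split.
- by move=> i ih; apply: xle; lia.
- by rewrite subnKC.
- by move: Hks; congr unit_exceedances; apply/funext => i; congr x; lia.
Qed.

Local Notation entry := (fun (j : nat) (x : nat -> nat) => x j).

Lemma leq_sample_max (x : nat -> nat) (n j : nat) :
  (j < n)%N -> (x j <= sample_max entry n x)%N.
Proof. by move=> jn; rewrite /sample_max (leq_bigmax_cond (Ordinal jn)). Qed.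

Lemma max_multiplicityE (x : nat -> nat) (n : nat) :
  max_multiplicity entry n x =
  (\sum_(0 <= j < n) (x j == sample_max entry n x))%N.
Proof. by rewrite /max_multiplicity big_mkord. Qed.

Lemma sample_max_attained (x : nat -> nat) (n : nat) :
  (0 < n)%N -> exists2 j, (j < n)%N & x j = sample_max entry n x.
Proof.
move=> n0; have [|i _ xi] := @eq_bigmax_cond _ 'I_n x; first by rewrite card_ord.
by exists i => //; rewrite /sample_max -xi.
Qed.

Lemma max_multiplicity_gt0 (x : nat -> nat) (n : nat) :
  (0 < n)%N -> (0 < max_multiplicity entry n x)%N.
Proof.
move=> /(sample_max_attained x)[j jn xj].
by rewrite /max_multiplicity (bigD1 (Ordinal jn))//= xj eqxx.
Qed.

Lemma unit_exceedances_max (x : nat -> nat) (n k m : nat) :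
  sample_max entry n x = k.+1 -> (m <= max_multiplicity entry n x)%N ->
  unit_exceedances (nseq m k) x.
Proof.
move=> xk; rewrite max_multiplicityE xk => mL.
apply/unit_exceedances_nseqP; exists n => // j jn.
by rewrite -xk leq_sample_max.
Qed.

Lemma max_unit_exceedances (x : nat -> nat) (k m : nat) :
  (0 < m)%N -> unit_exceedances (nseq m k) x ->
  exists n, sample_max entry n x = k.+1 /\ (m <= max_multiplicity entry n x)%N.
Proof.
move=> m0 /unit_exceedances_nseqP[n xle mn]; exists n.
have xk : sample_max entry n x = k.+1.
  apply/eqP; rewrite eqn_leq; apply/andP; split.
    by apply/bigmax_leqP => i _; exact: xle.
  have [j jn <-] : exists2 j, (j < n)%N & x j = k.+1.
    apply: contrapT => H; move: (leq_trans m0 mn).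
    rewrite big_nat big1 // => j /= jn.
    by apply/eqP; rewrite eqb0; apply/eqP => xj; apply: H; exists j.
  exact: leq_sample_max.
by split=> //; rewrite max_multiplicityE xk.
Qed.

(** A multiplicity at least 2 at time [n] is a double exceedance of the level
    [sample_max - 1], and these levels tend to infinity. *)
Lemma limn_esup_max_multiplicity_eq1 (R : realType) (x : nat -> nat) :
  (forall j, 0 < x j)%N -> (forall K, exists j, (K < x j)%N) ->
  (exists K, forall k, (K <= k)%N -> ~ unit_exceedances (nseq 2 k) x) ->
  limn_esup (fun n => ((max_multiplicity entry n x)%:R : R)%:E) = 1%E.
Proof.
move=> x0 xoo [K HK]; have [j0 Kj0] := xoo K.
suff Lcvg : ((max_multiplicity entry n x)%:R : R)%:E @[n --> \oo] --> 1%E.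
  by rewrite is_cvg_limn_esupE; [exact: cvg_lim|apply/cvg_ex; exists 1%E].
apply: cvg_near_cst; exists j0.+1 => // n /= jn.
have n0 : (0 < n)%N by exact: leq_trans jn.
suff -> : max_multiplicity entry n x = 1%N by [].
apply/eqP; rewrite eqn_leq max_multiplicity_gt0// andbT leqNgt.
apply/negP => L2; have Kmax : (K < sample_max entry n x)%N.
  by apply: leq_trans Kj0 _; exact: leq_sample_max.
apply: (HK (sample_max entry n x).-1); first by rewrite -ltnS prednK// (leq_trans _ Kmax).
by apply: unit_exceedances_max L2; rewrite prednK// (leq_trans _ Kmax).
Qed.

(** Given a time [N], a run at a level beyond the maximum of the first [N]
    entries can only be completed after time [N]. *)
Lemma limn_esup_max_multiplicity_eqy (R : realType) (x : nat -> nat) :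
  (forall m K, exists2 k, (K <= k)%N & unit_exceedances (nseq m.+1 k) x) ->
  limn_esup (fun n => ((max_multiplicity entry n x)%:R : R)%:E) = +oo%E.
Proof.
move=> Hx; apply/eqP; rewrite -leye_eq; apply: le_ereal_inf_tmp => _ [V [N _ NV] <-].
rewrite leye_eq; apply/eqP/eq_infty => r.
have [k Mk /(@max_unit_exceedances _ _ (Num.bound r).+1 isT)[n [xk mL]]] :=
  Hx (Num.bound r) (sample_max entry N x).
apply: le_ereal_sup_tmp; exists ((max_multiplicity entry n x)%:R%:E).
  exists n => //; apply: NV => /=; rewrite leqNgt; apply/negP => nN.
  suff: (sample_max entry n x <= sample_max entry N x)%N by rewrite xk leqNgt ltnS Mk.
  by apply/bigmax_leqP => i _; apply: leq_sample_max; exact: ltn_trans nN.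
rewrite lee_fin (le_trans (ltW (unstable.ltr_bound r)))// ler_nat.
exact: leq_trans (leqnSn _) mL.
Qed.

(** * Moments of the beta law *)

Definition beta_kernel (R : realType) (a b x : R) : R :=
  x `^ (a - 1) * (1 - x) `^ (b - 1).

Lemma measurable_beta_kernel (R : realType) (a b : R) :
  measurable_fun [set: R] (beta_kernel a b).
Proof.
apply: measurable_funM; first exact: measurable_powR.
apply: (@measurableT_comp _ _ _ _ _ _ (fun y : R => y `^ (b - 1)) _
  (fun x : R => 1 - x)); first exact: measurable_powR.
exact: measurable_funB.
Qed.

Lemma beta_kernel_ge0 (R : realType) (a b x : R) : 0 <= beta_kernel a b x.
Proof. by rewrite mulr_ge0// powR_ge0. Qed.

Lemma powR_mulB1 (R : realType) (x a : R) : 0 < x -> x `^ a = x * x `^ (a - 1).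
Proof.
move=> x0; rewrite powRB; last by rewrite (gt_eqF x0) implybT.
rewrite powRr1 ?ltW//.
by rewrite mulrCA divff ?mulr1// (gt_eqF x0).
Qed.

Lemma beta_kernelS (R : realType) (a b x : R) : 0 < x ->
  beta_kernel (a + 1) b x = x * beta_kernel a b x.
Proof. by move=> x0; rewrite /beta_kernel addrK (powR_mulB1 a x0) mulrA. Qed.

Section beta_moment.
Context (R : realType).
Variables (a b : R).
Hypotheses (a0 : 0 < a) (b0 : 0 < b).
Local Notation mu := (@lebesgue_measure R).

Let F (x : R) : R := x `^ a * (1 - x) `^ b.
Let f (x : R) : R := a * beta_kernel a b x - (a + b) * beta_kernel (a + 1) b x.

Let dpowR1B (c x : R) : x < 1 ->
  is_derive x 1 (fun y : R => (1 - y) `^ c) (- (c * (1 - x) `^ (c - 1))).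
Proof.
move=> x1; have x1' : 0 < 1 - x by rewrite subr_gt0.
have := @is_derive1_comp R (fun y => y `^ c) (fun y => 1 - y) x _ (-1)
  (is_derive1_powR c x1').
rewrite mulrN1; apply.
by rewrite -[X in is_derive _ _ _ X]sub0r; exact: is_deriveB.
Qed.

Let dF (x : R) : 0 < x -> x < 1 -> is_derive x 1 F (f x).
Proof.
move=> x0 x1; have x1' : 0 < 1 - x by rewrite subr_gt0.
have -> : f x = x `^ a *: - (b * (1 - x) `^ (b - 1)) +
               (1 - x) `^ b *: (a * x `^ (a - 1)).
  rewrite /f beta_kernelS// /beta_kernel (powR_mulB1 a x0) (powR_mulB1 b x1').
  rewrite /GRing.scale/=; ring.
apply: is_deriveM; [exact: is_derive1_powR|exact: dpowR1B].
Qed.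

Let derivable_kernel (c x : R) : 0 < x -> x < 1 ->
  derivable (beta_kernel c b) x 1.
Proof.
move=> x0 x1; apply: derivableM.
  by have [] := is_derive1_powR (c - 1) x0.
by have [] := dpowR1B (b - 1) x1.
Qed.

Let kernel_integrable (c e : R) : 0 < e ->
  mu.-integrable `[e, 1 - e] (EFin \o beta_kernel c b).
Proof.
move=> e0; apply: continuous_compact_integrable; first exact: segment_compact.
apply: derivable_within_continuous => x; rewrite in_itv/= => /andP[ex x1].
by apply: derivable_kernel; lra.
Qed.

(** Integrate the derivative of [x `^ a * (1 - x) `^ b].  The segment stays
    away from 0 and 1, where the kernel may be singular; the boundary term at
    [e] is at most [e `^ a] and the one at [1 - e] has the good sign. *)
Lemma beta_kernel_segment_le (e : R) : 0 < e -> e < 1 - e ->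
  ((a + b)%:E * \int[mu]_(x in `[e, (1 - e)%R]) (beta_kernel (a + 1) b x)%:E <=
   a%:E * \int[mu]_(x in `[e, (1 - e)%R]) (beta_kernel a b x)%:E +
   (e `^ a)%R%:E)%E.
Proof.
move=> e0 e1.
have FTC : (\int[mu]_(x in `[e, (1 - e)%R]) (f x)%:E = (F (1 - e))%:E - (F e)%:E)%E.
  apply: continuous_FTC2 => //.
  - apply: derivable_within_continuous => x; rewrite in_itv/= => /andP[ex x1].
    have [x0 x1'] : 0 < x /\ x < 1 by lra.
    have -> : f = (a *: beta_kernel a b) - ((a + b) *: beta_kernel (a + 1) b).
      by apply/funext.
    by apply: derivableB; apply: derivableZ; exact: derivable_kernel.
  - have dc (x : R) : 0 < x -> x < 1 -> F y @[y --> x] --> F x.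
      move=> x0 x1; have [d _] := dF x0 x1.
      by apply: differentiable_continuous; exact/derivable1_diffP.
    split.
    + move=> x; rewrite in_itv/= => /andP[ex x1].
      by have [] : is_derive x 1 F (f x) by apply: dF; lra.
    + by apply: cvg_at_right_filter; apply: dc; lra.
    + by apply: cvg_at_left_filter; apply: dc; lra.
  - move=> x; rewrite in_itv/= => /andP[ex x1].
    have d : is_derive x 1 F (f x) by apply: dF; lra.
    by rewrite derive1E derive_val.
have F1 : 0 <= F (1 - e) by rewrite mulr_ge0// powR_ge0.
have F2 : F e <= e `^ a.
  rewrite -[leRHS]mulr1 ler_wpM2l ?powR_ge0//.
  apply: (@le_trans _ _ (1 `^ b)); last by rewrite powR1.
  have [e1' e1''] : 0 <= 1 - e /\ 1 - e <= 1 by lra.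
  by apply: ge0_ler_powR; rewrite ?nnegrE/= ?(ltW b0).
have Ia := kernel_integrable a e0; have Ia1 := kernel_integrable (a + 1) e0.
have fE : (\int[mu]_(x in `[e, (1 - e)%R]) (f x)%:E =
    a%:E * \int[mu]_(x in `[e, (1 - e)%R]) (beta_kernel a b x)%:E -
    (a + b)%:E * \int[mu]_(x in `[e, (1 - e)%R]) (beta_kernel (a + 1) b x)%:E)%E.
  have intZ (k c : R) : mu.-integrable `[e, 1 - e]
      (fun x => k%:E * (beta_kernel c b x)%:E)%E.
    exact: (integrableZl _ _ (kernel_integrable c e0)).
  rewrite -!integralZl// -integralB//.
move: FTC; rewrite {}fE.
have Ifin c : (\int[mu]_(x in `[e, (1 - e)%R]) (beta_kernel c b x)%:E)%E
    \is a fin_num.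
  by apply: integrable_fin_num => //; exact: kernel_integrable.
rewrite -(fineK (Ifin a)) -(fineK (Ifin (a + 1))).
rewrite -!EFinM -!EFinB -EFinD => -[H]; rewrite lee_fin.
lra.
Qed.

(** One half of the recurrence of the beta function; it passes to the limit from
    the segments even if the integrals are infinite. *)
Lemma beta_kernel_moment_le :
  ((a + b)%:E * \int[mu]_(x in `]0%R, 1%R[) (beta_kernel (a + 1) b x)%:E <=
   a%:E * \int[mu]_(x in `]0%R, 1%R[) (beta_kernel a b x)%:E)%E.
Proof.
pose e n : R := n.+3%:R^-1.
have e0 n : 0 < e n by rewrite invr_gt0.
have e1 n : e n < 1 - e n.
  have : e n < 2^-1 by rewrite /e ltf_pV2 ?posrE// ltr_nat.
  by lra.
have e_small (y : {posnum R}) : exists N, forall n, (N <= n)%N -> e n <= y%:num.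
  exists (Num.bound y%:num^-1) => n Nn; rewrite /e invf_ple ?posrE//.
  rewrite (le_trans (ltW (unstable.ltr_bound _)))// ler_nat.
  by rewrite (leq_trans Nn)// 3?leqW.
have mK c : measurable_fun setT (EFin \o beta_kernel c b).
  by apply/measurable_EFinP; exact: measurable_beta_kernel.
have mKI c D : measurable_fun D (EFin \o beta_kernel c b).
  exact: measurable_funTS.
have cvI : (\int[mu]_(x in `[e n, (1 - e n)%R]) (beta_kernel (a + 1) b x)%:E
    @[n --> \oo] --> \int[mu]_(x in `]0%R, 1%R[) (beta_kernel (a + 1) b x)%:E)%E.
  have -> : `]0%R, 1%R[%classic = \bigcup_n `[e n, (1 - e n)%R]%classic.
    apply/seteqP; split=> [x|x [n _]] /=; rewrite !in_itv/= => /andP[x0 x1]; last first.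
      by have := e0 n; lra.
    have x1' : 0 < 1 - x by lra.
    have [n ne] := e_small (PosNum x0); have [m me] := e_small (PosNum x1').
    exists (maxn n m) => //=; rewrite in_itv/=.
    have := ne _ (leq_maxl n m); have := me _ (leq_maxr n m).
    by rewrite /=; lra.
  apply: ge0_nondecreasing_set_cvg_integral => //.
  - move=> m n mn; apply/subsetPset => x /=; rewrite !in_itv/= => /andP[x0 x1].
    have : e n <= e m by rewrite /e lef_pV2 ?posrE// ler_nat.
    by lra.
  - by move=> n; exact: mKI.
  - by move=> n x ?; rewrite lee_fin beta_kernel_ge0.
apply/lee_addgt0Pr => d d0.
have abI : ((a + b)%:E *
    \int[mu]_(x in `[e n, (1 - e n)%R]) (beta_kernel (a + 1) b x)%:E @[n --> \oo]
    --> (a + b)%:E * \int[mu]_(x in `]0%R, 1%R[) (beta_kernel (a + 1) b x)%:E)%E.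
  exact: cvgeZl.
rewrite -(cvg_lim _ abI)//; apply: lime_le; first exact: cvgP abI.
(* The boundary term [e n `^ a] is below [d] once [e n <= d `^ a^-1]. *)
have da0 : 0 < d `^ a^-1 by exact: powR_gt0.
have [N HN] := e_small (PosNum da0); exists N => // n /= /HN /= eN.
apply: le_trans (beta_kernel_segment_le (e0 n) (e1 n)) _.
rewrite leeD//.
  rewrite lee_pmul2l//; apply: ge0_subset_integral => //.
  - exact: mKI.
  - by move=> x ?; rewrite lee_fin beta_kernel_ge0.
  - move=> x /=; rewrite !in_itv/= => /andP[x0 x1].
    by have := e0 n; lra.
rewrite lee_fin; have -> : d = (d `^ a^-1) `^ a.
  by rewrite -powRrM mulVf ?gt_eqF// powRr1// ltW.
by apply: ge0_ler_powR; rewrite ?nnegrE ?(ltW (e0 n)) ?(ltW a0) ?(ltW da0).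
Qed.

End beta_moment.

(** The density agrees almost everywhere with the Radon-Nikodym derivative, for
    which the change of variables is known. *)
Lemma ge0_integral_density d (T : measurableType d) (R : realType)
    (mu : {sigma_finite_measure set T -> \bar R})
    (nu : {finite_measure set T -> \bar R}) (f : T -> R) (g : T -> \bar R) :
  measurable_fun [set: T] f -> (forall x, 0 <= f x) ->
  (forall A, measurable A -> nu A = \int[mu]_(x in A) (f x)%:E)%E ->
  measurable_fun [set: T] g -> (forall x, 0 <= g x)%E ->
  (\int[nu]_x g x = \int[mu]_x (g x * (f x)%:E))%E.
Proof.
move=> mf f0 nuE mg g0.
have mfE : measurable_fun [set: T] (EFin \o f) by exact/measurable_EFinP.
have numu : nu `<< mu.
  move=> N Nmu A mA AN; rewrite nuE// null_set_integral//; last exact: Nmu.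
  exact: measurable_funTS.
rewrite -(Radon_Nikodym_SigmaFinite.change_of_variables numu)//.
have mRN : measurable_fun [set: T] (Radon_Nikodym_SigmaFinite.f nu mu).
  exact: measurable_int (Radon_Nikodym_SigmaFinite.f_integrable numu).
apply: ge0_ae_eq_integral => //.
- exact: emeasurable_funM.
- exact: emeasurable_funM.
- move=> x _; rewrite mule_ge0//; exact: Radon_Nikodym_SigmaFinite.f_ge0.
- by move=> x _; rewrite mule_ge0// lee_fin.
apply: ae_eqe_mul2l; apply: integral_ae_eq => //.
  exact: Radon_Nikodym_SigmaFinite.f_integrable.
move=> E _ mE; rewrite -nuE//; apply/esym.
exact: Radon_Nikodym_SigmaFinite.f_integral.
Qed.

(** A stick length lies in ]0, 1[ only almost surely.  Forcing it there at every
    sample point makes all weights nonnegative and all geometric series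
    convergent without exceptional sets; 1/2 is an arbitrary interior value. *)
Definition unit_clamp (R : realType) (x : R) : R :=
  if (0 < x) && (x < 1) then x else 2^-1.

Lemma unit_clamp_gt0 (R : realType) (x : R) : 0 < unit_clamp x.
Proof. by rewrite /unit_clamp; case: ifPn => [/andP[]//|_]; rewrite invr_gt0. Qed.

Lemma unit_clamp_lt1 (R : realType) (x : R) : unit_clamp x < 1.
Proof.
by rewrite /unit_clamp; case: ifPn => [/andP[]//|_]; rewrite invf_lt1// ltr1n.
Qed.

Lemma unit_clamp_id (R : realType) (x : R) : x \in `]0, 1[ -> unit_clamp x = x.
Proof. by rewrite in_itv/= /unit_clamp => ->. Qed.

Lemma measurable_unit_clamp (R : realType) : measurable_fun [set: R] (@unit_clamp R).
Proof.
apply: measurable_fun_if => //.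
by apply: measurable_and; exact: measurable_fun_ltr.
Qed.

Section beta_law.
Context (R : realType) d (T : measurableType d) (P : probability T R).
Variables (a b : R) (H : {RV P >-> R}).
Hypotheses (a0 : 0 < a) (b0 : 0 < b) (HP : has_beta_law P a b H).
Local Notation mu := (@lebesgue_measure R).

Let E : R := euler_beta a b.

Let beta_density_ge0 (x : R) : 0 <= beta_density a b x.
Proof.
rewrite /beta_density patchE; case: ifPn => // _; rewrite -mulrA.
rewrite mulr_ge0 ?beta_kernel_ge0// invr_ge0.
by apply: Rintegral_ge0 => // t _; exact: beta_kernel_ge0.
Qed.

Let measurable_beta_density : measurable_fun [set: R] (@beta_density R a b).
Proof.
apply/(measurable_restrictT _ _).1 => //; apply: measurable_funTS.
rewrite (_ : (fun x => _) = (fun x => E^-1 * beta_kernel a b x)).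
  by apply: measurable_funM => //; exact: measurable_beta_kernel.
by apply/funext => x; rewrite -mulrA.
Qed.

Let integral_beta_density (g : R -> R) :
  measurable_fun [set: R] g -> (forall x, 0 <= g x) ->
  (\int[mu]_x ((g x)%:E * (beta_density a b x)%:E) =
   E^-1%:E * \int[mu]_(x in `]0%R, 1%R[) (g x * beta_kernel a b x)%:E)%E.
Proof.
move=> mg g0.
have mgk : measurable_fun [set: R] (fun x => g x * beta_kernel a b x).
  by apply: measurable_funM => //; exact: measurable_beta_kernel.
transitivity (\int[mu]_(x in `[0%R, 1%R]) (E^-1%:E * (g x * beta_kernel a b x)%:E))%E.
  rewrite [RHS]integral_mkcond; apply: eq_integral => x _.
  rewrite /beta_density !patchE; case: ifPn => _; last by rewrite mule0.
  by rewrite -!EFinM /beta_kernel; congr EFin; ring.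
have E0 : 0 <= E^-1.
  rewrite invr_ge0; apply: Rintegral_ge0 => // t _; exact: beta_kernel_ge0.
rewrite ge0_integralZl//; last 2 first.
- by apply: measurable_funTS; exact/measurable_EFinP.
- by move=> x _; rewrite lee_fin mulr_ge0// beta_kernel_ge0.
congr (_ * _)%E.
have mgkE D : measurable_fun D (fun x => (g x * beta_kernel a b x)%:E).
  by apply: measurable_funTS; exact/measurable_EFinP.
by rewrite -integral_itv_bndo_bndc// -integral_itv_obnd_cbnd.
Qed.

(* The constant [E] is positive and finite because the density has mass 1, so
   Euler's integral need not be studied. *)
Let beta_density1 : (E^-1%:E * \int[mu]_(x in `]0%R, 1%R[) (beta_kernel a b x)%:E = 1)%E.
Proof.
have := integral_beta_density (measurable_cst (1 : R)) (fun=> ler01).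
under eq_integral do rewrite mul1e.
rewrite -HP// preimage_setT probability_setT => E1; rewrite [RHS]E1.
by congr (_ * _)%E; apply: eq_integral => x _; rewrite /= mul1r.
Qed.

Lemma beta_law_unit : P (H @^-1` `]0, 1[) = 1%E.
Proof.
pose g : R -> R := \1_(`]0, 1[ : set R).
have mg : measurable_fun [set: R] g by exact: measurable_indic.
have g0 x : 0 <= g x by rewrite /g indicE.
have := integral_beta_density mg g0.
rewrite HP// -beta_density1 => E1.
rewrite integral_mkcond.
transitivity (\int[mu]_x ((g x)%:E * (beta_density a b x)%:E))%E.
  apply: eq_integral => x _; rewrite patchE /g indicE.
  by case: ifPn; rewrite (mul1e, mul0e).
rewrite E1; congr (_ * _)%E; apply: eq_integral => x x01.
by rewrite /g indicE x01 mul1r.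
Qed.

(** Two steps of the recurrence for the beta integrals. *)
Lemma beta_law_second_moment :
  (\int[P]_w (unit_clamp (H w) ^+ 2)%:E <=
   (a * (a + 1) / ((a + b) * (a + b + 1)))%:E)%E.
Proof.
pose g (x : R) : R := unit_clamp x ^+ 2.
have mg : measurable_fun [set: R] g.
  by apply: measurable_funX; exact: measurable_unit_clamp.
have g0 x : 0 <= g x by rewrite sqr_ge0.
have E0 : 0 <= E^-1.
  rewrite invr_ge0; apply: Rintegral_ge0 => // t _; exact: beta_kernel_ge0.
(* Lebesgue measure lives on [measurableTypeR R], a copy of [R] with the same
   measurable sets; the law of [H] has to be taken there. *)
have mH : measurable_fun [set: T] (H : T -> measurableTypeR R).
  move=> _ Y mY; have mY' : measurable (Y : set R) by exact: mY.
  by have /(_ measurableT Y mY') := @measurable_funP _ _ _ _ [set: T] H.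
pose H' : {mfun T >-> measurableTypeR R} :=
  HB.pack (H : T -> measurableTypeR R) (isMeasurableFun.Build _ _ _ _ _ mH).
have mgE : measurable_fun [set: measurableTypeR R] (EFin \o g).
  exact/measurable_EFinP.
have -> : (\int[P]_w (unit_clamp (H w) ^+ 2)%:E =
           \int[distribution P H']_x (EFin \o g) x)%E.
  by rewrite ge0_integral_distribution// => y; rewrite lee_fin.
rewrite (@ge0_integral_density _ _ _ mu (distribution P H') (beta_density a b))//.
rewrite integral_beta_density//.
rewrite (@eq_integral _ _ _ mu _ (EFin \o beta_kernel (a + 1 + 1) b)); last first.
  move=> x; rewrite inE => x01; rewrite /g unit_clamp_id//=.
  have x0 : 0 < x by move: x01; rewrite /= in_itv/= => /andP[].
  by rewrite !beta_kernelS// expr2 mulrA.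
have I1 := beta_kernel_moment_le a0 b0.
have I2 := beta_kernel_moment_le (addr_gt0 a0 ltr01) b0.
move: beta_density1 I1 I2.
set I0 := (\int[mu]_(x in `]0%R, 1%R[) (beta_kernel a b x)%:E)%E.
set J1 := (\int[mu]_(x in `]0%R, 1%R[) (beta_kernel (a + 1) b x)%:E)%E.
set J2 := (\int[mu]_(x in `]0%R, 1%R[) (beta_kernel (a + 1 + 1) b x)%:E)%E.
move=> EI0 I1 I2.
have ab0 : 0 < a + b by exact: addr_gt0.
have ab10 : 0 < a + b + 1 by exact: addr_gt0.
have a10 : 0 < a + 1 by exact: addr_gt0.
have abJ2 : (((a + b) * (a + b + 1))%:E * (E^-1%:E * J2) <= (a * (a + 1))%:E)%E.
  rewrite muleCA -[leRHS]mule1 -EI0 [leRHS]muleCA.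
  apply: lee_wpmul2l; first by rewrite lee_fin.
  rewrite EFinM -muleA addrAC.
  apply: (@le_trans _ _ ((a + b)%:E * ((a + 1)%:E * J1))%E).
    by apply: lee_wpmul2l I2; rewrite lee_fin ltW.
  rewrite muleCA [(a * _)%R]mulrC EFinM -muleA.
  by apply: lee_wpmul2l I1; rewrite lee_fin ltW.
rewrite -(@lee_pmul2l _ ((a + b) * (a + b + 1))%:E)//; last first.
  by rewrite lte_fin mulr_gt0.
apply: le_trans abJ2 _.
by rewrite -EFinM lee_fin [leRHS]mulrC divfK// gt_eqF// mulr_gt0.
Qed.
End beta_law.

(** * Independence and the second Borel-Cantelli lemma *)

(** The joint law agrees with the product of the laws on rectangles, hence
    everywhere, and Tonelli's theorem applies. *)
Lemma independent_seq_ge0_integralM (R : realType) d (T : measurableType d)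
    (P : probability T R) (H : nat -> {RV P >-> R}) (i j : nat) (f g : R -> R) :
  independent_seq P (fun k w => H k w) -> i != j ->
  measurable_fun [set: R] f -> measurable_fun [set: R] g ->
  (forall x, 0 <= f x) -> (forall x, 0 <= g x) ->
  (\int[P]_w (f (H i w) * g (H j w))%:E =
   \int[P]_w (f (H i w))%:E * \int[P]_w (g (H j w))%:E)%E.
Proof.
move=> indH ij mf mg f0 g0.
have mHH : measurable_fun [set: T] (fun w => (H i w, H j w)).
  by apply/measurable_fun_pairP; split; exact: measurable_funP.
pose HH : {mfun T >-> (R * R)%type} :=
  HB.pack (fun w => (H i w, H j w)) (isMeasurableFun.Build _ _ _ _ _ mHH).
have lawE X : measurable X ->
    (distribution P (H i) \x distribution P (H j))%E X = distribution P HH X.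
  apply: product_measure_unique => A B mA mB.
  have mAB (k : nat) : measurable (if k == i then A else B) by case: ifP.
  have := indH [:: i; j] (fun k => if k == i then A else B) _ mAB.
  rewrite /= inE ij => /(_ isT); rewrite !big_cons big_nil mule1 eqxx.
  rewrite eq_sym (negbTE ij) => <-; rewrite /distribution/= /pushforward/=.
  congr (P _); apply/seteqP; split=> [w [Aw Bw] k /=|w HAB].
    by rewrite !inE => /orP[] /eqP ->; rewrite ?eqxx// eq_sym (negbTE ij).
  split; first by have := HAB i; rewrite /= !inE !eqxx; apply.
  by have := HAB j; rewrite /= !inE eqxx orbT eq_sym (negbTE ij); apply.
pose F (z : R * R) : \bar R := (f z.1 * g z.2)%:E.
have mF : measurable_fun [set: R * R] F.
  apply/measurable_EFinP; apply: measurable_funM.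
    exact: measurableT_comp measurable_fst.
  exact: measurableT_comp measurable_snd.
have F0 z : (0 <= F z)%E by rewrite lee_fin mulr_ge0.
transitivity (\int[distribution P HH]_z F z)%E.
  by rewrite ge0_integral_distribution.
rewrite (eq_measure_integral (distribution P (H i) \x distribution P (H j))%E);
  last by move=> X mX _; exact/esym/lawE.
rewrite fubini_tonelli1//.
have mfE : measurable_fun [set: R] (EFin \o f) by exact/measurable_EFinP.
have mgE : measurable_fun [set: R] (EFin \o g) by exact/measurable_EFinP.
transitivity (\int[distribution P (H i)]_x
    ((f x)%:E * \int[distribution P (H j)]_y (g y)%:E))%E.
  apply: eq_integral => x _; rewrite /fubini_F /F/=.
  rewrite -ge0_integralZl_EFin//.
  by move=> y _; rewrite lee_fin.
rewrite ge0_integralZr//; last 2 first.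
- by move=> x _; rewrite lee_fin.
- by apply: integral_ge0 => y _; rewrite lee_fin.
by rewrite !ge0_integral_distribution// => y; rewrite lee_fin.
Qed.

(** Second moment argument.  Let [S] be the number of the first [n.+1] events
    that occur and [a = n.+1 * c] its mean.  The variance of [S] is at most
    [n.+1] while [(S - a) ^+ 2 = a ^+ 2] when no event occurs, so the probability
    of this is at most [1 / (n.+1 * c ^ 2)].  The negative term of
    [(S - a) ^+ 2] is moved to the other side to integrate nonnegative
    functions only. *)
Lemma pairwise_Borel_Cantelli (R : realType) d (T : measurableType d)
    (P : probability T R) (A : nat -> set T) (c : R) :
  (forall k, measurable (A k)) -> 0 < c -> (forall k, P (A k) = c%:E) ->
  (forall k l, k != l -> P (A k `&` A l) <= (c * c)%:E)%E ->
  P (\bigcap_k ~` A k) = 0%E.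
Proof.
move=> mA c0 PA PAA; set N := \bigcap_k ~` A k.
have mN : measurable N by apply: bigcap_measurable => // k _; exact: measurableC.
suff PN n : (P N * (n.+1%:R * (c * c))%:E <= 1)%E.
  have PNfin := fin_num_measure P _ mN.
  apply/eqP; rewrite eq_le measure_ge0 andbT -(fineK PNfin) lee_fin leNgt.
  apply/negP => q0; set q := fine (P N) in q0 *.
  have qcc : 0 < q * (c * c) by rewrite !mulr_gt0.
  have := PN (Num.bound (q * (c * c))^-1).
  rewrite -(fineK PNfin) -/q -EFinM lee_fin mulrCA.
  apply/negP; rewrite -ltNge -[ltLHS](mulVf (lt0r_neq0 qcc)) ltr_pM2r//.
  by rewrite (lt_le_trans (unstable.ltr_bound _))// ler_nat.
pose a : R := n.+1%:R * c.
have a0 : 0 <= a by rewrite mulr_ge0// ltW.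
have a2 : 0 <= 2 * a by rewrite mulr_ge0.
have ind0 (B : set T) w : 0 <= (\1_B w : R) by rewrite indicE.
pose S w : R := \sum_(k < n.+1) \1_(A k) w.
have S0 w : 0 <= S w by exact: sumr_ge0.
have mI (B : set T) : measurable B -> measurable_fun [set: T] (\1_B : T -> R).
  exact: measurable_indic.
have mS : measurable_fun [set: T] S by apply: measurable_sum => k; exact: mI.
have le2 : (\int[P]_w (a ^+ 2 * \1_N w + 2 * a * S w)%:E <=
            \int[P]_w (S w ^+ 2 + a ^+ 2)%:E)%E.
  apply: ge0_le_integral => //.
  - by move=> w _; rewrite lee_fin addr_ge0// mulr_ge0// sqr_ge0.
  - apply/measurable_EFinP; apply: measurable_funD.
      by apply: measurable_funM; [exact: measurable_cst|exact: mI].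
    by apply: measurable_funM; [exact: measurable_cst|exact: mS].
  - by apply/measurable_EFinP; apply: measurable_funD => //; exact: measurable_funX.
  - move=> w _; rewrite lee_fin.
    have [wN|wN] := boolP (w \in N); last first.
      by rewrite indicE (negbTE wN) mulr0 add0r; have := sqr_ge0 (S w - a); nra.
    rewrite (_ : S w = 0) ?mulr0 ?addr0 ?expr0n ?add0r ?indicE ?wN ?mulr1//.
    rewrite /S big1// => k _; rewrite indicE memNset//.
    by move: wN; rewrite inE => /(_ k I).
have ES : (\int[P]_w (S w)%:E = (n.+1%:R * c)%:E)%E.
  rewrite /S; under eq_integral do rewrite -sumEFin.
  rewrite ge0_integral_sum//; last by move=> k; apply/measurable_EFinP; exact: mI.
  rewrite (eq_bigr (fun=> c%:E)) => [|k _]; last first.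
    by rewrite integral_indic// setIT; exact: PA.
  by rewrite sumEFin sumr_const card_ord mulr_natl.
have ESS : (\int[P]_w (S w ^+ 2)%:E <= (a ^+ 2 + n.+1%:R)%:E)%E.
  rewrite (eq_integral (fun w => \sum_(k < n.+1) \sum_(l < n.+1)
      (\1_(A k `&` A l) w)%:E)%E); last first.
    move=> w _; rewrite expr2 /S big_distrlr/= -sumEFin.
    apply: eq_bigr => k _; rewrite -sumEFin; apply: eq_bigr => l _.
    by rewrite indicI.
  rewrite ge0_integral_sum//; last 2 first.
  - move=> k; apply: emeasurable_sum => l; apply/measurable_EFinP.
    by apply: mI; exact: measurableI.
  - by move=> k w _; apply: sume_ge0 => l _; rewrite lee_fin.
  have -> : a ^+ 2 + n.+1%:R = \sum_(k < n.+1) \sum_(l < n.+1) (c * c + (k == l)%:R).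
    under eq_bigr do rewrite big_split/= sumr_const card_ord.
    rewrite big_split/= sumr_const card_ord; congr (_ + _).
      by rewrite /a exprMn !expr2 -mulrnA -[RHS]mulr_natl natrM.
    rewrite (eq_bigr (fun=> 1)) => [|k _]; first by rewrite sumr_const card_ord.
    rewrite (bigD1 k)//= eqxx big1 ?addr0// => l lk.
    by rewrite eq_sym (negbTE lk).
  rewrite -sumEFin; apply: lee_sum => k _.
  rewrite ge0_integral_sum//; last first.
    by move=> l; apply/measurable_EFinP; apply: mI; exact: measurableI.
  rewrite -sumEFin; apply: lee_sum => l _.
  rewrite integral_indic//; last exact: measurableI.
  rewrite setIT; have [<-|kl] := eqVneq k l.
    rewrite setIid; apply: le_trans (probability_le1 P (mA _)) _.
    by rewrite lee_fin lerDr mulr_ge0 ?(ltW c0).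
  by rewrite addr0; exact: PAA.
have mSE : measurable_fun [set: T] (fun w => (S w)%:E) by exact/measurable_EFinP.
have mNE : measurable_fun [set: T] (fun w => (\1_N w : R)%:E).
  by apply/measurable_EFinP; exact: mI.
have lhsE : (\int[P]_w (a ^+ 2 * \1_N w + 2 * a * S w)%:E =
    (a ^+ 2)%:E * P N + (2 * a * a)%:E)%E.
  under eq_integral do rewrite EFinD (EFinM (a ^+ 2)) (EFinM (2 * a)).
  rewrite ge0_integralD//; last 4 first.
  - by move=> w _; rewrite -EFinM lee_fin mulr_ge0// sqr_ge0.
  - exact: measurable_funeM.
  - by move=> w _; rewrite -EFinM lee_fin mulr_ge0.
  - exact: measurable_funeM.
  rewrite !ge0_integralZl_EFin ?sqr_ge0//.
    by rewrite integral_indic// setIT ES -EFinM.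
  by move=> w _; rewrite lee_fin.
have rhsE : (\int[P]_w (S w ^+ 2 + a ^+ 2)%:E =
    \int[P]_w (S w ^+ 2)%:E + (a ^+ 2)%:E)%E.
  under eq_integral do rewrite EFinD.
  rewrite ge0_integralD//; last 3 first.
  - by move=> w _; rewrite lee_fin sqr_ge0.
  - by apply/measurable_EFinP; exact: measurable_funX.
  - by move=> w _; rewrite lee_fin sqr_ge0.
  rewrite integral_cst//; congr (_ + _)%E.
  by rewrite -[RHS]mule1; congr (_ * _)%E; exact: probability_setT.
have PNfin := fin_num_measure P _ mN.
move: le2; rewrite lhsE rhsE => le2.
have {le2} := le_trans le2 (leeD ESS (lexx _)).
rewrite -(fineK PNfin) -!EFinM -!EFinD !lee_fin /a => le2.
have n0 : 0 < n.+1%:R :> R by [].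
rewrite -(ler_pM2l n0) mulr1.
by lra.
Qed.

(** * Law of the exceedances under stick breaking *)

Lemma sigma_algebra_fun (R : realType) (T : pointedType) (G : set (set T))
    (f : T -> R) :
  (forall B : set R, measurable B -> <<s G>> (f @^-1` B)) <->
  measurable_fun [set: g_sigma_algebraType G] (f : g_sigma_algebraType G -> R).
Proof.
split=> [Gf _ B mB|mf B mB].
  by rewrite setTI; exact: Gf.
by have := mf measurableT B mB; rewrite setTI.
Qed.

(** The definition of the model prescribes the conditional probability of
    [X j <= k]; differences give that of [X j = k.+1]. *)
Lemma is_cond_probD (R : realType) d (T : measurableType d)
    (P : probability T R) (G : set (set T)) (A B : set T) (f g : T -> R) :
  <<s G>> `<=` measurable -> measurable A -> measurable B -> A `<=` B ->
  is_cond_prob P <<s G>> A f -> is_cond_prob P <<s G>> B g ->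
  is_cond_prob P <<s G>> (B `\` A) (fun w => g w - f w).
Proof.
move=> Gm mA mB AB [mf intf fE] [mg intg gE]; split.
- apply/sigma_algebra_fun; apply: measurable_funB; exact/sigma_algebra_fun.
- rewrite (_ : EFin \o _ = ((EFin \o g) \- (EFin \o f))%E)//.
  exact: integrableB.
- move=> C GC; have mC := Gm _ GC.
  under eq_integral do rewrite EFinB.
  rewrite integralB_EFin//; last 2 first.
  + by apply: integrableS intg.
  + by apply: integrableS intf.
  rewrite fE// gE// setIDAC setIDA measureD//; last 2 first.
  + exact: measurableI.
  + by rewrite (le_lt_trans (probability_le1 P (measurableI _ _ mB mC)))// ltry.
  congr (_ - P _)%E; apply/seteqP; split=> [w [Aw Cw]|w [[Bw Cw] Aw]] //.
  by split=> //; split=> //; exact: AB.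
Qed.

Lemma sigma_seq_measurable d (T : measurableType d) d' (T' : measurableType d')
    (Y : nat -> T -> T') :
  (forall k, measurable_fun [set: T] (Y k)) -> sigma_seq Y `<=` measurable.
Proof.
move=> mY; apply: smallest_sub; first exact: sigma_algebra_measurable.
by move=> _ [k _ [B mB <-]]; exact: mY.
Qed.

(** The letter [(k, false)] stands for a value at most [k], and [(k, true)] for
    the value [k.+1]. *)
Definition letter (c : nat * bool) : set nat :=
  [set x | if c.2 then x == c.1.+1 else (x <= c.1)%N].

Definition starts_with (v : seq (nat * bool)) (x : nat -> nat) : Prop :=
  forall j, (j < size v)%N -> letter (nth (0%N, false) v j) (x j).

Lemma starts_with_cat (u v : seq (nat * bool)) (x : nat -> nat) :
  starts_with (u ++ v) x <->
  starts_with u x /\ starts_with v (fun i => x (size u + i)%N).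
Proof.
split=> [uv|[xu xv] j].
  split=> j jn; last first.
    have := uv (size u + j)%N; rewrite size_cat ltn_add2l => /(_ jn).
    by rewrite nth_cat ltnNge leq_addr/= addKn.
  have := uv j; rewrite size_cat nth_cat jn; apply.
  exact: ltn_addr.
rewrite size_cat nth_cat => juv; case: ltnP => ju; first exact: xu.
by have := xv (j - size u)%N; rewrite subnKC//; apply; rewrite ltn_subLR.
Qed.

(** [g] values at most [k], then [k.+1]: the possible ways to overshoot the level
    [k] by 1 for the first time. *)
Definition exceedance_word (k g : nat) : seq (nat * bool) :=
  rcons (nseq g (k, false)) (k, true).

Lemma starts_with_exceedance_word (k g : nat) (x : nat -> nat) :
  starts_with (exceedance_word k g) x <->
  (forall i, (i < g)%N -> (x i <= k)%N) /\ x g = k.+1.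
Proof.
rewrite /starts_with /exceedance_word size_rcons size_nseq; split=> [xw|[xlt xg] j].
  split=> [i ig|].
    have := xw i (ltnW ig); rewrite nth_rcons size_nseq ig nth_nseq ig.
    exact.
  by have := xw g (ltnSn g); rewrite nth_rcons size_nseq ltnn eqxx => /eqP.
rewrite ltnS leq_eqVlt nth_rcons size_nseq => /predU1P[->|jg].
  by rewrite ltnn eqxx; exact/eqP.
by rewrite jg nth_nseq jg; exact: xlt.
Qed.

Lemma unit_exceedances_consP (k : nat) (ks : seq nat) (x : nat -> nat) :
  unit_exceedances (k :: ks) x <->
  exists g, starts_with (exceedance_word k g) x /\
            unit_exceedances ks (fun i => x (g.+1 + i)%N).
Proof.
split=> [[g [xlt xg xks]]|[g [/starts_with_exceedance_word[xlt xg] xks]]].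
  by exists g; split=> //; exact/starts_with_exceedance_word.
by exists g.
Qed.

Section gem.
Context (R : realType) d (T : measurableType d) (P : probability T R).
Variables (H : nat -> {RV P >-> R}) (X : nat -> {RV P >-> nat}).
Let Y := stick_breaking (fun i w => H i w).
Hypothesis H01 : forall i, P (H i @^-1` `]0, 1[) = 1%E.
Hypothesis Xind : cond_independent_seq P (sigma_seq Y) (fun j w => X j w).
Hypothesis XY : forall j k,
  is_cond_prob P (sigma_seq Y) [set w | (X j w <= k)%N] (Y k).

Definition stick (k : nat) (w : T) : R := unit_clamp (H k w).

Definition residual (k : nat) (w : T) : R := \prod_(i < k) (1 - stick i w).

(** Conditional probability of a letter given the sticks. *)
Definition letter_weight (c : nat * bool) (w : T) : R :=
  if c.2 then residual c.1 w * stick c.1 w else 1 - residual c.1 w.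

Lemma measurable_stick k : measurable_fun [set: T] (stick k).
Proof.
apply: (@measurableT_comp _ _ _ _ _ _ (@unit_clamp R)) => //.
exact: measurable_unit_clamp.
Qed.

Lemma measurable_residual k : measurable_fun [set: T] (residual k).
Proof.
apply: measurable_prod => i _; apply: measurable_funB => //.
exact: measurable_stick.
Qed.

Lemma measurable_letter_weight c : measurable_fun [set: T] (letter_weight c).
Proof.
rewrite /letter_weight; case: c.2.
  by apply: measurable_funM; [exact: measurable_residual|exact: measurable_stick].
by apply: measurable_funB => //; exact: measurable_residual.
Qed.

Lemma stick_gt0 k w : 0 < stick k w. Proof. exact: unit_clamp_gt0. Qed.
Lemma stick_lt1 k w : stick k w < 1. Proof. exact: unit_clamp_lt1. Qed.

Lemma residual_gt0 k w : 0 < residual k w.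
Proof. by apply: prodr_gt0 => i _; rewrite subr_gt0 stick_lt1. Qed.

Lemma residual_le1 k w : residual k w <= 1.
Proof.
apply: prodr_ile1 => i _; rewrite subr_ge0 (ltW (stick_lt1 i w))/=.
by rewrite gerBl (ltW (stick_gt0 i w)).
Qed.

Lemma letter_weight_ge0 c w : 0 <= letter_weight c w.
Proof.
rewrite /letter_weight; case: c.2; last by rewrite subr_ge0 residual_le1.
by rewrite mulr_ge0// ltW// (residual_gt0, stick_gt0).
Qed.

Let measurable_Y k : measurable_fun [set: T] (Y k).
Proof.
rewrite /Y /stick_breaking; apply: measurable_funB => //.
by apply: measurable_prod => i _; exact: measurable_funB.
Qed.

Let cond_letter j c : is_cond_prob P (sigma_seq Y) (X j @^-1` letter c)
  (fun w => if c.2 then Y c.1.+1 w - Y c.1 w else Y c.1 w).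
Proof.
have mX k : measurable [set w | (X j w <= k)%N].
  by rewrite -[X in measurable X]setTI; exact: (measurable_funP (X j) measurableT [set x | (x <= k)%N]).
case: c => k [] /=; last exact: XY.
rewrite (_ : _ @^-1` _ = [set w | (X j w <= k.+1)%N] `\` [set w | (X j w <= k)%N]).
  apply: is_cond_probD => //; first exact: sigma_seq_measurable.
  by move=> w /= /leqW.
apply/seteqP; split=> w /=; rewrite /letter/=.
  by move=> /eqP ->; rewrite ltnn.
by move=> [Xk /negP]; rewrite -ltnNge => kX; rewrite eqn_leq Xk kX.
Qed.

Let residualE : \forall w \ae P, forall k, Y k w = 1 - residual k w.
Proof.
have : \forall w \ae P, forall i, H i w \in `]0, 1[.
  apply: ae_foralln => i; have mHi : measurable (H i @^-1` `]0, 1[).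
    by rewrite -[X in measurable X]setTI; exact: (measurable_funP (H i) measurableT).
  exists (~` (H i @^-1` `]0, 1[)); split; first exact: measurableC.
    transitivity (1 - P (H i @^-1` `]0%R, 1%R[))%E; first exact: probability_setC.
    by rewrite H01 subee.
  by move=> w.
apply: filterS => w Hw k; rewrite /Y /stick_breaking /residual.
by congr (1 - _); apply: eq_bigr => i _; rewrite /stick unit_clamp_id.
Qed.

(** Given the sticks the entries are independent, so the weights multiply; the
    clamped sticks may be used because they agree almost surely with the
    original ones. *)
Lemma starts_with_law v : P [set w | starts_with v (fun j => X j w)] =
  (\int[P]_w (\prod_(c <- v) letter_weight c w)%:E)%E.
Proof.
pose c0 := (0%N, false).
pose A j := letter (nth c0 v j).
pose f j w := let c := nth c0 v j in
  if c.2 then Y c.1.+1 w - Y c.1 w else Y c.1 w.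
have [_ _ lawE] : is_cond_prob P (sigma_seq Y)
    (\bigcap_(j in `I_(size v)) X j @^-1` A j)
    (fun w => \prod_(j < size v) f j w).
  by apply: Xind => j _ //; exact: cond_letter.
have GT : sigma_seq Y setT.
  by rewrite -(@setC0 T); apply: sigma_algebraC; exact: sigma_algebra0.
have {lawE GT} := lawE setT GT; rewrite setIT => lawE.

rewrite (_ : [set w | _] = \bigcap_(j in `I_(size v)) X j @^-1` A j) -?lawE//.
have wE w : (\prod_(c <- v) letter_weight c w =
    \prod_(j < size v) letter_weight (nth c0 v j) w).
  by rewrite (big_nth c0) big_mkord.
apply: ae_eq_integral => //.
- apply/measurable_EFinP; apply: measurable_prod => j _; rewrite /f/=.
  by case: (nth c0 v j).2 => //; exact: measurable_funB.
- apply/measurable_EFinP; apply: measurable_prod => c _.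
  exact: measurable_letter_weight.
apply: filterS residualE => w Yw _; congr EFin; rewrite wE.
apply: eq_bigr => j _; rewrite /f/= /letter_weight !Yw; case: (nth c0 v j).2 => //.
by rewrite [residual _.+1 _]/residual big_ord_recr/= -/(residual _ _); ring.
Qed.

Let after (v : seq (nat * bool)) (ks : seq nat) : set T :=
  [set w | starts_with v (fun j => X j w) /\
           unit_exceedances ks (fun i => X (size v + i)%N w)].

Let after_cons v k ks :
  after v (k :: ks) = \bigcup_g after (v ++ exceedance_word k g) ks.
Proof.
have sE g : size (v ++ exceedance_word k g) = (size v + g.+1)%N.
  by rewrite size_cat size_rcons size_nseq.
apply/seteqP; split=> w.
  move=> [xv /unit_exceedances_consP[g [xg xks]]]; exists g => //; split.
    exact/starts_with_cat.
  by rewrite sE; under eq_fun do rewrite -addnA.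
move=> [g _ [/starts_with_cat[xv xg]]].
rewrite sE; under eq_fun do rewrite -addnA.
by move=> xks; split=> //; apply/unit_exceedances_consP; exists g.
Qed.

Let measurable_after v ks : measurable (after v ks).
Proof.
elim: ks v => [|k ks IHks] v; last first.
  by rewrite after_cons; apply: bigcup_measurable => g _; exact: IHks.
rewrite (_ : after v [::] =
    \bigcap_(j in `I_(size v)) X j @^-1` letter (nth (0%N, false) v j)).
  apply: bigcap_measurableType => j _; rewrite -[X in measurable X]setTI.
  exact: (measurable_funP (X j) measurableT).
by apply/seteqP; split=> w; [case|].
Qed.

(* Sum over the length [g] of the word: the geometric series of ratio
   [1 - residual k w] turns the weight [residual * stick] of the last letter
   into [stick]. *)
Let geometric_weight (k : nat) (w : T) (c : R) :
  (\sum_(0 <= g <oo)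
     (c * \prod_(a <- exceedance_word k g) letter_weight a w)%:E =
   (c * stick k w)%:E)%E.
Proof.
pose z := 1 - residual k w.
have r0 := residual_gt0 k w; have r1 := residual_le1 k w.
have z1 : `|z| < 1.
  by rewrite ger0_norm /z ?subr_ge0// ltrBlDr ltrDl.
have lim_c := @cvg_geometric_series R (c * (residual k w * stick k w)) z z1.
rewrite (_ : (fun n => _) =
    EFin \o series (geometric (c * (residual k w * stick k w)) z)); last first.
  apply/funext => n /=; rewrite /series/= -sumEFin; apply: eq_bigr => g _.
  rewrite /exceedance_word big_rcons/= big_nseq iter_mulr_1 /letter_weight/=.
  by congr EFin; rewrite -/z; ring.
rewrite EFin_lim; last exact: cvgP lim_c.
rewrite (cvg_lim _ lim_c)//; congr EFin; rewrite /z subKr.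
by rewrite -mulrA; congr (_ * _); rewrite mulrAC divff ?mul1r ?gt_eqF.
Qed.

(** Each level contributes the corresponding stick.  The induction on the levels
    needs the statement after an arbitrary prefix [v], since consuming a level
    extends the prefix by an exceedance word. *)
Lemma unit_exceedances_law ks :
  P [set w | unit_exceedances ks (fun j => X j w)] =
  (\int[P]_w (\prod_(k <- ks) stick k w)%:E)%E.
Proof.
suff lawE v : P (after v ks) = (\int[P]_w
    (\prod_(c <- v) letter_weight c w * \prod_(k <- ks) stick k w)%:E)%E.
  have := lawE [::]; under eq_integral do rewrite big_nil mul1r.
  by move=> <-; congr (P _); apply/seteqP; split=> w //= [].
elim: ks v => [|k ks IHks] v.
  under eq_integral do rewrite big_nil mulr1.
  by rewrite -starts_with_law; congr (P _); apply/seteqP; split=> w //= [].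
rewrite after_cons measure_semi_bigcup//; last 2 first.
(* The words are incompatible: the length [g] is the position of the first
   entry above [k]. *)
- apply/trivIsetP => g h _ _ gh; apply/seteqP; split=> // w [].
  move=> [/starts_with_cat[_ /starts_with_exceedance_word[glt gx]] _].
  move=> [/starts_with_cat[_ /starts_with_exceedance_word[hlt hx]] _].
  move: gh; have [/hlt|/glt|//] := ltngtP g h.
    by rewrite gx ltnn.
  by rewrite hx ltnn.
- by rewrite -after_cons.
transitivity (\sum_(0 <= g <oo) \int[P]_w
    ((\prod_(c <- v) letter_weight c w * \prod_(l <- ks) stick l w) *
     \prod_(a <- exceedance_word k g) letter_weight a w)%:E)%E.
  apply: eq_eseriesr => g _; apply: etrans (IHks _) _; apply: eq_integral => w _.
  by rewrite big_cat/= mulrAC.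
rewrite -integral_nneseries//; last 2 first.
- move=> g; apply/measurable_EFinP; apply: measurable_funM.
    apply: measurable_funM; apply: measurable_prod => a _.
      exact: measurable_letter_weight.
    exact: measurable_stick.
  by apply: measurable_prod => a _; exact: measurable_letter_weight.
- move=> g w _; rewrite lee_fin !mulr_ge0//; apply: prodr_ge0 => a _;
    rewrite ?letter_weight_ge0//.
  exact/ltW/stick_gt0.
apply: eq_integral => w _; rewrite geometric_weight big_cons.
by congr EFin; ring.
Qed.

Lemma measurable_unit_exceedances ks :
  measurable [set w | unit_exceedances ks (fun j => X j w)].
Proof.
rewrite (_ : [set w | _] = after [::] ks); first exact: measurable_after.
by apply/seteqP; split=> w //= [].
Qed.

Lemma measurable_bounded_sample K :
  measurable [set w | forall j, (X j w <= K)%N].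
Proof.
rewrite (_ : [set w | _] = \bigcap_j X j @^-1` [set x | (x <= K)%N]).
  apply: bigcap_measurableType => j _; rewrite -[X in measurable X]setTI.
  exact: (measurable_funP (X j) measurableT).
by apply/seteqP; split=> w Bw j; [move=> _; exact: Bw|exact: Bw].
Qed.

(** The sample exceeds every level, since the conditional probability
    [(1 - residual K) ^+ n] that the first [n] entries do not tends to 0. *)
Lemma bounded_sample_null K : P [set w | forall j, (X j w <= K)%N] = 0%E.
Proof.
set B := [set w | _]; have mB : measurable B by exact: measurable_bounded_sample.
have PB n : (P B <= \int[P]_w ((1 - residual K w) ^+ n)%:E)%E.
  have -> : (\int[P]_w ((1 - residual K w) ^+ n)%:E =
      P (after (nseq n (K, false)) [::]))%E.
    rewrite (_ : after _ _ =
      [set w | starts_with (nseq n (K, false)) (fun j => X j w)]); last first.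
      by apply/seteqP; split=> w //= [].
    rewrite starts_with_law; apply: eq_integral => w _.
    by rewrite big_nseq iter_mulr_1.
  apply: le_measure; rewrite ?inE//.
  move=> w Bw; split=> // j; rewrite size_nseq => jn.
  by rewrite nth_nseq jn; exact: Bw.
have res0 w : 0 <= 1 - residual K w by rewrite subr_ge0 residual_le1.
have res1 w : 1 - residual K w < 1 by rewrite ltrBlDr ltrDl residual_gt0.
have [_ _] : [/\ P.-integrable setT (cst 0%E : T -> \bar R),
    [sequence \int[P]_w `|((1 - residual K w) ^+ n)%:E - 0| ]_n @ \oo --> 0%E
  & [sequence \int[P]_w ((1 - residual K w) ^+ n)%:E]_n @ \oo -->
    (\int[P]_w 0)%E]%E.
  apply: (@dominated_convergence _ _ _ P setT measurableT
    (fun n w => ((1 - residual K w) ^+ n)%:E) (cst 0%E) (cst 1%E)) => //.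
  - move=> n; apply/measurable_EFinP; apply: measurable_funX.
    by apply: measurable_funB => //; exact: measurable_residual.
  - apply: aeW => w _; apply: cvg_EFin; first exact: nearW.
    by apply: cvg_expr; rewrite ger0_norm.
  - exact: finite_measure_integrable_cst.
  - apply: aeW => w n _; rewrite /= lee_fin ger0_norm ?exprn_ge0//.
    by rewrite exprn_ile1// ltW.
rewrite integral0 => cvg0; apply/eqP; rewrite eq_le measure_ge0 andbT.
rewrite -(cvg_lim _ cvg0)//; apply: lime_ge; first exact: cvgP cvg0.
by apply: nearW => n; exact: PB.
Qed.
End gem.

(** * Measurability of the limit superior *)

Section measurability.
Context (R : realType) d (T : measurableType d) (X : nat -> T -> nat).
Hypothesis mX : forall j, measurable_fun [set: T] (X j).

Lemma measurable_sample_max n : measurable_fun [set: T] (sample_max X n).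
Proof.
elim: n => [|n IHn].
  by rewrite (_ : sample_max X 0 = cst 0%N)//; apply/funext => w; rewrite /sample_max big_ord0.
rewrite (_ : sample_max X n.+1 = fun w => maxn (sample_max X n w) (X n w)).
  exact: measurable_fun_maxn.
by apply/funext => w; rewrite /sample_max big_ord_recr.
Qed.

Lemma measurable_max_multiplicity n : measurable_fun [set: T] (max_multiplicity X n).
Proof.
suff mS m : measurable_fun [set: T]
    (fun w => \sum_(j < m) (X j w == sample_max X n w))%N by exact: mS.
elim: m => [|m IHm].
  by under eq_fun do rewrite big_ord0; exact: measurable_cst.
under eq_fun do rewrite big_ord_recr/=.
apply: measurable_fun_addn => //.
apply: (@measurableT_comp _ _ _ _ _ _ nat_of_bool) => //.
by apply: measurable_fun_eqn => //; exact: measurable_sample_max.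
Qed.

Lemma measurable_limn_esup_max_multiplicity (c : \bar R) :
  measurable [set w | limn_esup (fun n => ((max_multiplicity X n w)%:R : R)%:E) = c].
Proof.
have mL : measurable_fun [set: T]
    (fun w => limn_esup (fun n => ((max_multiplicity X n w)%:R : R)%:E)).
  apply: measurable_fun_limn_esup => n; apply/measurable_EFinP.
  apply: (@measurableT_comp _ _ _ _ _ _ (fun m : nat => m%:R : R)) => //.
  exact: measurable_max_multiplicity.
by have := mL measurableT [set c] (emeasurable_set1 c); rewrite setTI.
Qed.
End measurability.

Lemma sigma_seq_limn_esup_max_multiplicity (R : realType) (c : \bar R) :
  sigma_seq entry [set x : nat -> nat |
    limn_esup (fun n => ((max_multiplicity entry n x)%:R : R)%:E) = c].
Proof.
pose G := \bigcup_k preimage_set_system setT (entry k) (@measurable _ nat).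
apply: (@measurable_limn_esup_max_multiplicity R _ (g_sigma_algebraType G) entry).
move=> j _ B mB; apply: sub_sigma_algebra; exists j => //.
by exists B.
Qed.

(** * The limit superior of the multiplicity of the maximum *)

Lemma has_beta_law_ge0_integral_eq (R : realType) d (T : measurableType d)
    (P : probability T R) (a b : R) (H1 H2 : {RV P >-> R}) (f : R -> R) :
  has_beta_law P a b H1 -> has_beta_law P a b H2 ->
  measurable_fun [set: R] f -> (forall x, 0 <= f x) ->
  (\int[P]_w (f (H1 w))%:E = \int[P]_w (f (H2 w))%:E)%E.
Proof.
move=> H1P H2P mf f0.
have mfE : measurable_fun [set: R] (EFin \o f) by exact/measurable_EFinP.
have f0E x : (0 <= (EFin \o f) x)%E by rewrite lee_fin.
rewrite -[LHS](ge0_integral_distribution H1 mfE f0E).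
rewrite -[RHS](ge0_integral_distribution H2 mfE f0E).
apply: eq_measure_integral => A mA _.
exact: etrans (H1P A mA) (esym (H2P A mA)).
Qed.

Lemma ae_not_null (R : realType) d (T : measurableType d)
    (mu : {measure set T -> \bar R}) (N : set T) :
  measurable N -> mu N = 0%E -> \forall w \ae mu, ~ N w.
Proof. by move=> mN N0; exists N; split=> // w /= /contrapT. Qed.

Lemma ae_probability1 (R : realType) d (T : measurableType d)
    (P : probability T R) (A : set T) :
  measurable A -> (\forall w \ae P, A w) -> P A = 1%E.
Proof.
move=> mA [N [mN N0 AN]]; have mAC := measurableC mA.
have PAC : P (~` A) = 0%E by exact: subset_measure0 N0.
by rewrite -[A]setCK (probability_setC P mAC) PAC sube0.
Qed.

Section gem_limsup.
Context (R : realType) d (T : measurableType d) (P : probability T R).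
Variables (alpha theta : R) (H : nat -> {RV P >-> R}) (X : nat -> {RV P >-> nat}).
Hypotheses (alpha0 : 0 <= alpha) (alpha1 : alpha < 1) (thetaN : - alpha < theta).
Hypothesis gemX : gem_construction alpha theta H X.

Let H_indep : independent_seq P (fun i w => H i w). Proof. by case: gemX. Qed.

Let H_law i : has_beta_law P (1 - alpha) (theta + i.+1%:R * alpha) (H i).
Proof. by case: gemX. Qed.

Let a_gt0 : 0 < 1 - alpha. Proof. by rewrite subr_gt0. Qed.

Let b_gt0 (i : nat) : 0 < theta + i.+1%:R * alpha.
Proof.
have ia0 : 0 <= i%:R * alpha by rewrite mulr_ge0.
have ta0 : 0 < theta + alpha by rewrite -[alpha]opprK subr_gt0.
by rewrite -natr1 mulrDl mul1r addrCA ltr_wpDl.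
Qed.

Let H01 i : P (H i @^-1` `]0, 1[) = 1%E.
Proof. exact: beta_law_unit (H_law i). Qed.

Let exceedance_law ks :
  P [set w | unit_exceedances ks (fun j => X j w)] =
  (\int[P]_w (\prod_(k <- ks) stick H k w)%:E)%E.
Proof. by case: gemX => _ _ _ Xind XY; exact: unit_exceedances_law. Qed.

Let bounded_null K : P [set w | forall j, (X j w <= K)%N] = 0%E.
Proof. by case: gemX => _ _ _ Xind XY; exact: bounded_sample_null. Qed.

Let mE ks : measurable [set w | unit_exceedances ks (fun j => X j w)].
Proof. exact: measurable_unit_exceedances. Qed.

(** First Borel-Cantelli lemma for the double exceedances. *)
Lemma gem_limn_esup_eq1 : 0 < alpha ->
  P [set w | limn_esup
    (fun n => ((max_multiplicity (fun j w => X j w) n w)%:R : R)%:E) = 1%E] = 1%E.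
Proof.
move=> alpha_gt0; have al0 := alpha0; have al1 := alpha1; have thN := thetaN.
pose A k := [set w | unit_exceedances (nseq 2 k) (fun j => X j w)].
pose s := 1 + theta.
have s0 : 0 < s by rewrite /s; lra.
have PA k : (P (A k) <= (2 / alpha * ((s + k%:R * alpha)^-1 -
                                      (s + k.+1%:R * alpha)^-1))%:E)%E.
  rewrite /A exceedance_law; under eq_integral do rewrite !big_cons big_nil mulr1.
  apply: le_trans (beta_law_second_moment a_gt0 (b_gt0 k) (H_law k)) _.
  (* [t] is the sum of the two parameters of the law of the stick [k]; since
     [alpha < 1], replacing [t + 1] by [t + alpha] makes the bound telescope. *)
  set t := s + k%:R * alpha.
  have t0 : 0 < t by rewrite ltr_wpDr// mulr_ge0.
  have -> : s + k.+1%:R * alpha = t + alpha by rewrite /t -natr1; ring.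
  have -> : 1 - alpha + (theta + k.+1%:R * alpha) = t.
    by rewrite /t /s -natr1; ring.
  have -> : 2 / alpha * (t^-1 - (t + alpha)^-1) = 2 / (t * (t + alpha)).
    field; lra.
  rewrite lee_fin ler_pM//.
  - by rewrite mulr_ge0//; lra.
  - by rewrite invr_ge0 mulr_ge0//; lra.
  - by nra.
  - by rewrite lef_pV2 ?posrE ?mulr_gt0 ?ler_pM2l//; lra.
have lim_sup0 : P (lim_sup_set A) = 0%E.
  apply: lim_sup_set_cvg0; first by move=> k; exact: mE.
  apply: (@le_lt_trans _ _ (2 / alpha / s)%:E); last by rewrite ltry.
  apply: lime_le; first by apply: is_cvg_nneseries => k _ _; exact: measure_ge0.
  apply: nearW => n; apply: (@le_trans _ _ (\sum_(0 <= k < n)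
      (2 / alpha * ((s + k%:R * alpha)^-1 - (s + k.+1%:R * alpha)^-1))%:E)%E).
    by apply: lee_sum => k _; exact: PA.
  rewrite sumEFin lee_fin -mulr_sumr.
  rewrite (telescope_sumr_eq (fun k => - (s + k%:R * alpha)^-1))//; last first.
    by move=> k _; rewrite opprK addrC.
  rewrite opprK mul0r addr0 ler_wpM2l//; first by rewrite divr_ge0// ltW.
  by rewrite addrC gerBl invr_ge0 addr_ge0 ?(ltW s0)// mulr_ge0.
have mL := @measurable_limn_esup_max_multiplicity R _ _ (fun j w => X j w)
  (fun j => measurable_funP (X j)).
apply: ae_probability1; first exact: mL.
have mlim : measurable (lim_sup_set A).
  by apply: bigcap_measurableType => n _; apply: bigcup_measurable => k _; exact: mE.
have := ae_not_null mlim lim_sup0.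
have : \forall w \ae P, forall K, ~ (forall j, (X j w <= K)%N).
  apply: ae_foralln => K; apply: ae_not_null (bounded_null K).
  exact: measurable_bounded_sample.
apply: filterS2 => w Mw Aw.
apply: (@limn_esup_max_multiplicity_eq1 R (fun j => X j w)).
- by move=> j; case: gemX.
- move=> K; apply: contrapT => H'; apply: (Mw K) => j; rewrite leqNgt.
  by apply/negP => Kj; apply: H'; exists j.
- apply: contrapT => H'; apply: Aw => K _; apply: contrapT => H''.
  by apply: H'; exists K => k Kk Ak; apply: H''; exists k.
Qed.

(** Here the sticks have the same law, and the second Borel-Cantelli lemma applies
    to the runs of each length at the levels beyond any [K]. *)
Lemma gem_limn_esup_eqy : alpha = 0 ->
  P [set w | limn_esup
    (fun n => ((max_multiplicity (fun j w => X j w) n w)%:R : R)%:E) = +oo%E] = 1%E.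
Proof.
move=> alpha_eq0.
pose A m k := [set w | unit_exceedances (nseq m.+1 k) (fun j => X j w)].
pose f m (x : R) := unit_clamp x ^+ m.+1.
have mf m : measurable_fun [set: R] (f m).
  by apply: measurable_funX; exact: measurable_unit_clamp.
have f0 m x : 0 < f m x by rewrite exprn_gt0// unit_clamp_gt0.
have f0' m x : 0 <= f m x by exact: ltW.
have prod_nseq m k w : \prod_(l <- nseq m.+1 k) stick H l w = f m (H k w).
  by rewrite big_nseq iter_mulr_1.
have mfH m k : measurable_fun [set: T] (fun w => (f m (H k w))%:E).
  by apply/measurable_EFinP; exact: measurableT_comp.
pose c m := fine (\int[P]_w (f m (H 0 w))%:E)%E.
have fE m k : (\int[P]_w (f m (H k w))%:E = (c m)%:E)%E.
  transitivity (\int[P]_w (f m (H 0%N w))%:E)%E.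
    apply: (@has_beta_law_ge0_integral_eq _ _ _ _ (1 - alpha) theta) => //.
      by have := H_law k; rewrite alpha_eq0 mulr0 addr0.
    by have := H_law 0; rewrite alpha_eq0 mulr0 addr0.
  rewrite fineK// ge0_fin_numE; last by apply: integral_ge0 => w _; rewrite lee_fin.
  apply: (@le_lt_trans _ _ (\int[P]_w (cst 1%E w))%E); last first.
    by rewrite integral_cst// mul1e; apply: le_lt_trans (probability_le1 P _) _; rewrite ?ltry.
  apply: ge0_le_integral => //; first by move=> w _; rewrite lee_fin.
  move=> w _; rewrite lee_fin /f exprn_ile1//; apply: ltW.
    exact: unit_clamp_gt0.
  exact: unit_clamp_lt1.
have c0 m : 0 < c m.
  rewrite lt_neqAle eq_sym; apply/andP; split; last first.
    by apply: fine_ge0; apply: integral_ge0 => w _; rewrite lee_fin.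
  apply/eqP => cm0; have := fE m 0%N; rewrite cm0 => int0.
  have [N [mN N0 fN]] : \forall w \ae P, setT w -> (f m (H 0%N w))%:E = 0%E.
    apply/(ae_eq_integral_abs P measurableT (mfH m 0%N)).
    by under eq_integral do rewrite gee0_abs ?lee_fin//.
  have : (P setT <= P N)%E.
    apply: le_measure; rewrite ?inE// => w _; apply: fN => /(_ I) [] fw0.
    by have := f0 m (H 0%N w); rewrite fw0 ltxx.
  by rewrite N0 probability_setT lee_fin ler10.
have PA m k : P (A m k) = (c m)%:E.
  by rewrite /A exceedance_law; under eq_integral do rewrite prod_nseq.
have PAA m k l : (k < l)%N -> (P (A m k `&` A m l) <= (c m * c m)%:E)%E.
  move=> kl; apply: (@le_trans _ _ (P [set w |
      unit_exceedances (nseq m.+1 k ++ nseq m.+1 l) (fun j => X j w)])).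
    apply: le_measure; rewrite ?inE; [|exact: mE|].
      by apply: measurableI; exact: mE.
    by move=> w [Ak Al]; exact: unit_exceedances_cat.
  rewrite exceedance_law; under eq_integral do rewrite big_cat/= !prod_nseq.
  rewrite (independent_seq_ge0_integralM H_indep)//; last by rewrite ltn_eqF.
  by rewrite !fE.
have often m K : P (\bigcap_k ~` A m (K + k)%N) = 0%E.
  apply: (@pairwise_Borel_Cantelli _ _ _ _ _ (c m)) => //.
    by move=> k; exact: mE.
  move=> k l; rewrite neq_ltn => /orP[kl|lk].
    by apply: PAA; rewrite ltn_add2l.
  by rewrite setIC; apply: PAA; rewrite ltn_add2l.
have mL := @measurable_limn_esup_max_multiplicity R _ _ (fun j w => X j w)
  (fun j => measurable_funP (X j)).
apply: ae_probability1; first exact: mL.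
have : \forall w \ae P, forall m K, ~ (\bigcap_k ~` A m (K + k)%N) w.
  apply: ae_foralln => m; apply: ae_foralln => K.
  apply: ae_not_null; last exact: often.
  by apply: bigcap_measurableType => k _; apply: measurableC; exact: mE.
apply: filterS => w Aw.
apply: (@limn_esup_max_multiplicity_eqy R (fun j => X j w)) => m K.
apply: contrapT => H'; apply: (Aw m K) => k _ Ak; apply: H'.
by exists (K + k)%N => //; exact: leq_addr.
Qed.
End gem_limsup.

Theorem theorem5 (R : realType) (d : measure_display) (T : measurableType d)
    (P : probability T R) (alpha theta : R) (X : nat -> {RV P >-> nat})
    (halpha0 : 0 <= alpha) (halpha1 : alpha < 1) (htheta : - alpha < theta)
    (hX : gem_exchangeable alpha theta X) :
  let L := max_multiplicity (fun j w => X j w) in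
  (0 < alpha ->
     P [set w | limn_esup (fun n => ((L n w)%:R : R)%:E) = 1%E] = 1%E) /\
  (alpha = 0 ->
     P [set w | limn_esup (fun n => ((L n w)%:R : R)%:E) = +oo%E] = 1%E).
Proof.
have [_ [d' [T' [P' [H [X' [gemX' lawE]]]]]]] := hX.
(* The event is measurable for the sequence, so it may be studied on the space
   that carries the sticks. *)
have transfer c := lawE _ (@sigma_seq_limn_esup_max_multiplicity R c).
split=> [alpha_gt0|alpha_eq0]; apply: etrans (transfer _) _.
  exact: (gem_limn_esup_eq1 halpha0 halpha1 htheta gemX').
exact: gem_limn_esup_eqy gemX' alpha_eq0.
Qed.
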